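(* Let $q=p^r$ with $p$ prime, $m\ge2$, $b\in\mathbb F_q^*$, and let $t$ be a positive divisor of $m$ with $p\nmid\frac mt$. Let $\gamma_t$ be a primitive element of $\mathbb F_{q^t}$, $g=\operatorname{N}_{\mathbb F_{q^t}/\mathbb F_q}(\gamma_t)$, and $d=\gcd(\frac mt,q-1)$, and assume $d\mid\operatorname{ind}_g b$. Let $i_0$ be a solution of $\frac{m}{dt}\,i\equiv\frac{\operatorname{ind}_g b}{d}\pmod{\frac{q-1}{d}}$. Then \[ N_t(0,b)=d\Bigl(\frac{q^{t-1}-1}{q-1}+\frac1q\sum_{x\in\mathbb F_{q^t}}e\bigl(\gamma_t^{i_0}x^{s}\bigr)\Bigr), \] where $s=\gcd(t,\frac{q-1}{d})$.
   Context: For a positive divisor $t$ of $m$, regard $\mathbb F_{q^t}\subseteq\mathbb F_{q^m}$ and let $N_t(a,b)$ be the number of $x\in\mathbb F_{q^t}^*$ with $\operatorname{Tr}_{\mathbb F_{q^m}/\mathbb F_q}(x)=a$ and $\operatorname{N}_{\mathbb F_{q^m}/\mathbb F_q}(x)=b$. $\operatorname{ind}_g b$ is the discrete logarithm of $b$ to base $g$. $e$ is the canonical additive character of $\mathbb F_{q^t}$, $e(y)=\exp(2\pi i\operatorname{Tr}_{\mathbb F_{q^t}/\mathbb F_p}(y)/p)$. *)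

(* Defs.v *)
From HB Require Import structures.
From mathcomp Require Import all_boot all_order all_algebra all_fingroup all_field.
From mathcomp Require Import complex reals trigo.
Set Implicit Arguments.
Unset Strict Implicit.
Unset Printing Implicit Defensive.
Import GRing.Theory Num.Theory.
Local Open Scope ring_scope.
Local Open Scope complex_scope.

(* exp(i theta) *)
Definition expi (R : realType) (theta : R) : R[i] := cos theta +i* sin theta.

Section FiniteFields.
Variables (p : nat) (F : finFieldType) (charF : p \in [pchar F]).

(* F itself, with the structures of a finite field and of a (splitting) field
   extension of 'F_p; the subfields of F are then the K : {subfield L}. *)
Local Notation L := (pPrimeCharType charF).
Implicit Types (k K E : {subfield L}) (a b g x y z : L).

(* The relative trace and norm of E / k are galTrace k E and galNorm k E. *)

Definition primitive_element K g : Prop :=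
  [/\ g \in K, g != 0 & forall y, y \in K -> y != 0 -> exists n : nat, y = g ^+ n].

(* Discrete logarithm: the least n with g ^+ n = b (it is less than the order
   of g); the value #|L| is returned when b is not a power of g. *)
Definition ind g b : nat := index b [seq g ^+ n | n <- iota 0 #|L|].

(* The representative 0 <= n < p of an element z of the prime subfield 1%AS;
   the value p is returned when z is not in the prime subfield. *)
Definition prime_rep z : nat := index z [seq n%:R | n <- iota 0 p].

(* Canonical additive character of K: e(y) = exp(2 pi i Tr_{K/F_p}(y) / p). *)
Definition add_char (R : realType) K y : R[i] :=
  expi (2 * pi * (prime_rep (galTrace 1%AS K y))%:R / p%:R).

(* N_t(a, b) for k = F_q and K = F_{q^t}; trace and norm are those of L / k. *)
Definition count_trace_norm k K a b : nat :=
  #|[set x : L | [&& x \in K, x != 0,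
                     galTrace k {:L}%AS x == a & galNorm k {:L}%AS x == b]]|.

End FiniteFields.

(* Main.v *)
(* Write K = F_(q^t), k = F_q, Q = q^t - 1, c = Q / (q - 1), n = m / t and
   M = (q - 1) / d.  For x in K the trace over k is n Tr_(K/k)(x) and the norm
   is x^(c n), so the norm condition holds exactly for x = gamma^i0 z with
   z^(c d) = 1.  Detecting Tr_(K/k)(x) = 0 by the average of e(l x) over l in k
   leaves a double sum over z and the nonzero l, that is over the (c d)-th and
   the (q - 1)-th roots of unity.  Parametrising these by z = y^M and l = w^c,
   with w and y ranging over K^*, the product l z = w^c y^M runs over
   the multiset of all x^s, x in K^*, repeated Q times, as s = gcd(c, M). *)

Require Import Defs.
From HB Require Import structures.
From mathcomp Require Import all_boot all_order all_algebra all_fingroup all_field.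
From mathcomp Require Import complex reals trigo.
From mathcomp Require Import cyclic ring lra.
Set Implicit Arguments.
Unset Strict Implicit.
Unset Printing Implicit Defensive.
Import Order.TTheory GRing.Theory Num.Theory.
Local Open Scope ring_scope.
Local Open Scope complex_scope.

(** * Block decomposition of indices, and sums over roots of unity *)

Lemma big_ord_mul (T : Type) (idx : T) (op : Monoid.law idx) n t (f : nat -> T) :
  \big[op/idx]_(k < n * t) f k
    = \big[op/idx]_(i < n) \big[op/idx]_(j < t) f (i * t + j)%N.
Proof.
elim: n => [|n IHn]; first by rewrite !big_ord0.
rewrite big_ord_recr -IHn /= -!(big_mkord xpredT) mulSn addnC.
rewrite (big_cat_nat (leq0n _) (leq_addr _ _)) /=; congr (op _ _).
rewrite -{1}[(n * t)%N]add0n big_addn addKn.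
by rewrite big_mkord; apply: eq_bigr => i _; rewrite addnC.
Qed.

Section UnityRoots.
Variables (L : finFieldType) (V : nmodType).
Implicit Types (z : L) (h : L -> V).

Lemma sum_unity_roots N z h : N.-primitive_root z ->
  \sum_(x | x ^+ N == 1) h x = \sum_(i < N) h (z ^+ i).
Proof.
move=> prim_z; rewrite -(@big_imset _ _ _ _ _ (fun i : 'I_N => z ^+ i) predT) /=.
  apply: eq_bigl => x; apply/eqP/imsetP => [xN1 | [i _ ->]].
    by have [i ->] := prim_rootP prim_z xN1; exists i.
  by rewrite exprAC (prim_expr_order prim_z) expr1n.
move=> i j _ _ /eqP; rewrite (eq_prim_root_expr prim_z) !modn_small // => /eqP.
exact: val_inj.
Qed.

(** The map x |-> x^n sends the n N-th roots of unity onto the N-th ones, n to one: for x = z^(i N +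
    j) the power x^n depends on j only. *)
Lemma sum_unity_roots_exp n N z h : (n * N).-primitive_root z ->
  \sum_(x | x ^+ (n * N) == 1) h (x ^+ n) = (\sum_(x | x ^+ N == 1) h x) *+ n.
Proof.
move=> prim_z; rewrite (sum_unity_roots _ prim_z).
have [n0 N0] : (0 < n /\ 0 < N)%N.
  by apply/andP; rewrite -muln_gt0 (prim_order_gt0 prim_z).
have prim_zn : N.-primitive_root (z ^+ n).
  by have := dvdn_prim_root prim_z (dvdn_mull n (dvdnn N)); rewrite mulnK.
rewrite (sum_unity_roots _ prim_zn) -iter_addr_0 -big_const_ord.
rewrite (big_ord_mul _ _ _ (fun k => h ((z ^+ k) ^+ n))).
apply: eq_bigr => i _; apply: eq_bigr => j _; congr (h _).
by rewrite exprAC exprD mulnC exprM (prim_expr_order prim_zn) expr1n mul1r.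
Qed.

(* The matrix (c/s, M/s; v, u), of determinant 1 when u c = v M + s, acts
   bijectively on pairs of Q-th roots of unity, and turns (w, y) |-> w^c y^M
   into (x, _) |-> x^s. *)
Lemma sum_unity_roots_gcd Q c M h : (0 < Q)%N -> (0 < c)%N ->
  \sum_(w | w ^+ Q == 1) \sum_(y | y ^+ Q == 1) h (w ^+ c * y ^+ M) =
  (\sum_(x | x ^+ Q == 1) h (x ^+ gcdn c M)) *+ #|[pred x : L | x ^+ Q == 1]|.
Proof.
move=> Q0 c0; have [u v Duv _] := egcdnP M c0; set s := gcdn c M in Duv *.
have s0 : (0 < s)%N by rewrite gcdn_gt0 c0.
pose c' := (c %/ s)%N; pose M' := (M %/ s)%N.
have Dc : c = (c' * s)%N by rewrite divnK ?dvdn_gcdl.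
have DM : M = (M' * s)%N by rewrite divnK ?dvdn_gcdr.
have Ddet : (u * c' = v * M' + 1)%N.
  by apply/eqP; rewrite -(eqn_pmul2r s0) mulnDl -!mulnA -Dc -DM mul1n Duv.
(* The multiplicity on the right becomes a second, idle summation variable, so that both sides are
   sums over pairs. *)
rewrite -sumrMnl -[RHS](eq_bigr _ (fun x _ => sumr_const _ _)).
rewrite !pair_big /=.
pose phi (a : L * L) := (a.1 ^+ c' * a.2 ^+ M', a.1 ^+ v * a.2 ^+ u).
(* This is the inverse matrix (u, -M/s; -v, c/s), acting on exponents. *)
pose psi (a : L * L) := (a.1 ^+ u / a.2 ^+ M', a.2 ^+ c' / a.1 ^+ v).
have neq0 (x : L) : x ^+ Q == 1 -> x != 0.
  by apply: contraTneq => ->; rewrite expr0n gtn_eqF // eq_sym oner_eq0.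
have torQ (x y : L) i j : x ^+ Q == 1 -> y ^+ Q == 1 -> (x ^+ i * y ^+ j) ^+ Q == 1.
  move=> /eqP xQ /eqP yQ.
  by rewrite exprMn -!exprM ![(_ * Q)%N]mulnC !exprM xQ yQ !expr1n mul1r.
rewrite [RHS](reindex_onto phi psi) /=; last first.
  move=> [x z] /= /andP[xQ zQ]; have x0 := neq0 _ xQ; have z0 := neq0 _ zQ.
  rewrite /phi /psi /= !expr_div_n -!exprM Ddet exprD expr1 [(v * u)%N]mulnC.
  rewrite ![(M' * _)%N]mulnC [(c' * u)%N]mulnC Ddet exprD expr1.
  have A0 := expf_neq0 (v * M') x0; have B0 := expf_neq0 (c' * M') z0.
  have C0 := expf_neq0 (u * v) x0; have D0 := expf_neq0 (v * M') z0.
  by congr (_, _); field; apply/andP.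
apply: eq_big => [[w y]|[w y] _] /=; last first.
  by rewrite [in LHS]Dc [in LHS]DM !exprM -exprMn.
(* The summation ranges agree: [phi] preserves pairs of Q-th roots of unity, and conversely w and y
   are the entries of [psi] at such a pair. *)
rewrite inE; apply/andP/andP => [[wQ yQ]|[/andP[]]]; last first.
  rewrite /psi /=; set X := _ * _; set Y := _ * _ => XQ YQ /eqP[Dw Dy].
  by rewrite -Dw -Dy -!exprVn; split; apply: torQ; rewrite // exprVn invr_eq1.
split; first by rewrite !torQ.
have w0 := neq0 _ wQ; have y0 := neq0 _ yQ.
rewrite /phi /psi /= !exprMn -!exprM ![(M' * _)%N]mulnC ![(c' * _)%N]mulnC Ddet.
rewrite !exprD !expr1.
have A0 := expf_neq0 (v * M') w0; have B0 := expf_neq0 (u * M') y0.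
have C0 := expf_neq0 (v * c') w0; have D0 := expf_neq0 (v * M') y0.
by apply/eqP; congr (_, _); field; apply/andP.
Qed.

End UnityRoots.

(** * Trace and norm through powers of the Frobenius *)

Section Frobenius.
Variables (F : finFieldType) (L : splittingFieldType F).
Implicit Types (k K E : {subfield L}).

Lemma gal_frobenius K E : (K <= E)%VS ->
  exists2 a : gal_of E, ('Gal(E / K) = <[a]>)%g
    & forall i, {in E, forall x, (a ^+ i)%g x = x ^+ ((#|F| ^ \dim K) ^ i)}.
Proof.
move=> sKE; have [a /eqP defG Da] := finField_galois_generator sKE.
exists a => // i x Ex; elim: i => [|i IHi]; first by rewrite gal_id.
by rewrite expgSr galM ?IHi // rmorphXn /= Da // -exprM expnS.
Qed.

(** The Galois group is cyclic, generated by the Frobenius of K, whose cardinality is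
    [#|F| ^ \dim K]. The operation is kept abstract to cover trace and norm at once. *)
Lemma big_gal_frobenius (T : Type) (idx : T) (op : Monoid.com_law idx)
    K E (f : L -> T) x : (K <= E)%VS -> x \in E ->
  \big[op/idx]_(a in 'Gal(E / K)%g) f (a x)
    = \big[op/idx]_(i < \dim_K E) f (x ^+ ((#|F| ^ \dim K) ^ i)).
Proof.
move=> sKE Ex; have [a defG Da] := gal_frobenius sKE.
have ->: \dim_K E = #[a]%g by rewrite (galois_dim (finField_galois sKE)) defG.
have ->: ('Gal(E / K) : {set _})%g = [set (a ^+ (i : 'I_#[a]))%g | i in predT].
  apply/setP=> z; rewrite defG; apply/idP/imsetP => [/cyclePmin[i lti ->]|[i _ ->]].
    by exists (Ordinal lti).
  exact: mem_cycle.
rewrite big_imset /=; last first.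
  move=> i j _ _ /eqP; rewrite eq_expg_mod_order !modn_small // => /eqP.
  exact: val_inj.
by apply: eq_bigr => i _; rewrite Da.
Qed.

Lemma galTraceE K E x : (K <= E)%VS -> x \in E ->
  galTrace K E x = \sum_(i < \dim_K E) x ^+ ((#|F| ^ \dim K) ^ i).
Proof. exact: (@big_gal_frobenius _ _ _ K E id). Qed.

Lemma galNormE K E x : (K <= E)%VS -> x \in E ->
  galNorm K E x = x ^+ (\sum_(i < \dim_K E) (#|F| ^ \dim K) ^ i).
Proof. by move=> sKE Ex; rewrite expr_sum; exact: (@big_gal_frobenius _ _ _ K E id). Qed.

Lemma dim_tower k K E : (k <= K)%VS -> (K <= E)%VS ->
  \dim_k E = (\dim_K E * \dim_k K)%N.
Proof.
move=> skK sKE; apply/eqP; rewrite -(eqn_pmul2r (adim_gt0 k)).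
by rewrite -mulnA !divnK ?field_dimS // (subv_trans skK).
Qed.

Lemma expn_dim_mul k K i j : (k <= K)%VS ->
  ((#|F| ^ \dim k) ^ (i * \dim_k K + j) = (#|F| ^ \dim K) ^ i * (#|F| ^ \dim k) ^ j)%N.
Proof.
move=> skK; rewrite -!expnM -expnD mulnDr mulnCA [(\dim k * _)%N]mulnC.
by rewrite divnK ?field_dimS // mulnC.
Qed.

(** Raising to the power |K| fixes x, so the conjugates of x over k run [\dim_K E] times through
    those coming from Gal(K/k). *)
Lemma big_gal_sub (T : Type) (idx : T) (op : Monoid.com_law idx)
    k K E (f : L -> T) x : (k <= K)%VS -> (K <= E)%VS -> x \in K ->
  \big[op/idx]_(a in 'Gal(E / k)%g) f (a x)
    = iter (\dim_K E) (op (\big[op/idx]_(a in 'Gal(K / k)%g) f (a x))) idx.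
Proof.
move=> skK sKE Kx; rewrite !big_gal_frobenius ?(subv_trans skK) ?(subvP sKE) //.
rewrite (dim_tower skK sKE) -big_const_ord.
rewrite (big_ord_mul _ _ _ (fun i => f (x ^+ ((#|F| ^ \dim k) ^ i)))).
apply: eq_bigr => i _; apply: eq_bigr => j _; rewrite expn_dim_mul // exprM.
congr (f (_ ^+ _)); elim: (val i) => //= n IHn.
by rewrite expnSr exprM IHn; apply/eqP; rewrite -Fermat's_little_theorem.
Qed.

Lemma galTrace_sub k K E x : (k <= K)%VS -> (K <= E)%VS -> x \in K ->
  galTrace k E x = galTrace k K x *+ \dim_K E.
Proof. by rewrite -iter_addr_0; exact: (@big_gal_sub _ _ _ k K E id). Qed.

Lemma galNorm_sub k K E x : (k <= K)%VS -> (K <= E)%VS -> x \in K ->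
  galNorm k E x = galNorm k K x ^+ \dim_K E.
Proof. by rewrite -iter_mulr_1; exact: (@big_gal_sub _ _ _ k K E id). Qed.

Lemma galTrace_trans k K E x : (k <= K)%VS -> (K <= E)%VS -> x \in E ->
  galTrace k E x = galTrace k K (galTrace K E x).
Proof.
move=> skK sKE Ex; have skE := subv_trans skK sKE.
have KT := mem_galTrace (finField_galois sKE) Ex.
(* The powers of [a] are ring morphisms, so raising to the power |k|^j passes through the inner sum
   that expresses the trace over K. *)
have [a _ Da] := gal_frobenius skE.
rewrite [RHS]galTraceE // (galTraceE skE) // (dim_tower skK sKE).
rewrite (big_ord_mul _ _ _ (fun i => x ^+ ((#|F| ^ \dim k) ^ i))) exchange_big.
apply: eq_bigr => j _; rewrite -Da ?(subvP sKE) // galTraceE // rmorph_sum /=.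
by apply: eq_bigr => i _; rewrite expn_dim_mul // exprM Da // rpredX.
Qed.

Lemma galTraceZ k E c x : (k <= E)%VS -> c \in k ->
  galTrace k E (c * x) = c * galTrace k E x.
Proof.
move=> skE kc; rewrite /galTrace mulr_sumr; apply: eq_bigr => a Ga.
by rewrite rmorphM /= (fixed_gal skE Ga kc).
Qed.

(** Distinct automorphisms are linearly independent, so their sum is not the zero map. *)
Lemma galTrace_neq0 k E : (k <= E)%VS -> exists2 x, x \in E & galTrace k E x != 0.
Proof.
move=> skE.
have [x Ex] := @gal_independent_contra _ L E (mem 'Gal(E / k)%g) (fun=> 1) 1%g
  (group1 _) (oner_neq0 _).
by under eq_bigr do rewrite mul1r; exists x.
Qed.

End Frobenius.

(** * The complex exponential and p-th roots of unity *)

Section Expi.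
Variable R : realType.

Lemma expi0 : expi (0 : R) = 1.
Proof. by rewrite /expi cos0 sin0. Qed.

Lemma expiD (a b : R) : expi (a + b) = expi a * expi b.
Proof. by rewrite /expi cosD sinD [in RHS]/GRing.mul /=; congr (_ +i* _); rewrite addrC mulrC. Qed.

Lemma expiX (a : R) n : expi (a * n%:R) = expi a ^+ n.
Proof.
elim: n => [|n IHn]; first by rewrite mulr0 expi0.
by rewrite exprS -IHn -expiD -{2}[a]mulr1 -mulrDr addrC natr1.
Qed.

(** The order divides the prime p. Order 1 would give cos(2 pi / p) = 1, hence sin(pi / p) = 0 by
    the double angle formula, although 0 < pi / p < pi. *)
Lemma expi_prim_root p : prime p -> p.-primitive_root (expi (2 * pi / p%:R : R)).
Proof.
move=> pr_p; have p0 : p%:R != 0 :> R by rewrite pnatr_eq0 -lt0n prime_gt0.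
have wp1 : expi (2 * pi / p%:R : R) ^+ p = 1.
  by rewrite -expiX divfK // mulr_natl /expi cos2pi sin2pi.
have [m prim_m dvd_mp] := prim_order_exists (prime_gt0 pr_p) wp1.
have [_ /(_ m dvd_mp) /orP[/eqP m1|/eqP mp]] := primeP pr_p;
  last by rewrite mp in prim_m.
have := prim_expr_order prim_m; rewrite m1 expr1 => -[c1 _].
have : 0 < sin (pi / p%:R : R).
  apply: sin_gt0_pi; rewrite divr_gt0 ?pi_gt0 ?ltr0n ?prime_gt0 //=.
  by rewrite ltr_pdivrMr ?ltr0n ?prime_gt0 // ltr_pMr ?pi_gt0 // ltr1n prime_gt1.
have := cos2Dsin2 (pi / p%:R : R).
move: c1; rewrite -mulrA mulr_natl cos_mulr2n.
nra.
Qed.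

End Expi.

(** * The canonical additive character and its orthogonality relation *)

Section AddChar.
Variables (R : realType) (p : nat) (F : finFieldType) (charF : p \in [pchar F]).
Local Notation L := (pPrimeCharType charF).
Implicit Types (k K E : {subfield L}) (x y z : L).

Let pr_p : prime p := pcharf_prime charF.

Lemma prime_rep_nat n : prime_rep (n%:R : L) = (n %% p)%N.
Proof.
have chL : p \in [pchar L] by [].
rewrite /prime_rep -(GRing.natr_mod_pchar chL).
have lt_n : (n %% p < p)%N by rewrite ltn_pmod ?prime_gt0.
have {1}-> : ((n %% p)%:R : L) = nth 0 [seq i%:R | i <- iota 0 p] (n %% p).
  by rewrite (nth_map 0%N) ?size_iota // nth_iota.
rewrite index_uniq ?size_map ?size_iota // map_inj_in_uniq ?iota_uniq // => i j.
rewrite !mem_iota /= !add0n => lt_i lt_j.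
wlog le_ij : i j lt_i lt_j / (i <= j)%N => [th|].
  by have [/th|/ltnW/th th'] := leqP i j; [exact | move=> /esym/th' ->].
move=> /esym/eqP; rewrite -subr_eq0 -natrB // -(dvdn_pcharf chL) => dvd_p.
apply/eqP; rewrite eqn_leq le_ij -subn_eq0 /=.
by apply: contraLR dvd_p; rewrite -lt0n => /gtnNdvd->//; rewrite (leq_ltn_trans (leq_subr _ _)).
Qed.

Lemma mem1_natr x : x \in (1%AS : {subfield L}) -> exists n : nat, x = n%:R.
Proof. by case/vlineP=> k ->; exists k; rewrite /GRing.scale /= /pprimeChar_scale mulr1. Qed.

Local Notation w := (expi (2 * pi / p%:R : R)).

(** Since [w] has order p, any natural number representing the trace may replace its reduced
    representative; additivity then needs no carry. *)
Lemma add_charE K y n : galTrace 1%AS K y = n%:R -> add_char R K y = w ^+ n.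
Proof.
move=> Tr_y; rewrite /add_char Tr_y prime_rep_nat -[in RHS](prim_expr_mod (expi_prim_root R pr_p)).
by rewrite -expiX mulrAC.
Qed.

Lemma add_char_Tr_nat K y : y \in K -> exists n : nat, galTrace 1%AS K y = n%:R.
Proof.
by move=> Ky; apply: mem1_natr; apply: mem_galTrace => //; rewrite finField_galois ?sub1v.
Qed.

Lemma add_charD K y z : y \in K -> z \in K ->
  add_char R K (y + z) = add_char R K y * add_char R K z.
Proof.
move=> /add_char_Tr_nat[a Da] /add_char_Tr_nat[b Db].
rewrite (add_charE Da) (add_charE Db) -exprD; apply: add_charE.
by rewrite raddfD /= Da Db natrD.
Qed.

Lemma add_char0 K : add_char R K 0 = 1.
Proof. by rewrite (@add_charE K 0 0) ?raddf0. Qed.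

(** Translation by an element z of nonzero trace multiplies the sum by e(z), which differs from
    1. *)
Lemma sum_add_char K : \sum_(y in K) add_char R K y = 0.
Proof.
have [z Kz Tz] := galTrace_neq0 (sub1v K); have [n Dn] := add_char_Tr_nat Kz.
apply: contraNeq Tz => S0; rewrite Dn -(dvdn_pcharf (charF : p \in [pchar L])).
rewrite (prim_order_dvd (expi_prim_root R pr_p)) -(add_charE Dn).
apply/eqP/(mulfI S0); rewrite mulr1 mulrC mulr_sumr [RHS](reindex_inj (addrI z)) /=.
by apply: eq_big => y; rewrite ?rpredDl // => Ky; rewrite add_charD.
Qed.

(** By transitivity of the trace, e_K(c x) = e_k(c T) with T = Tr_(K/k)(x). If T is nonzero, c |-> c
    T permutes k and the sum vanishes. *)
Lemma sum_add_charM k K x : (k <= K)%VS -> x \in K ->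
  \sum_(c in k) add_char R K (c * x) = #|k|%:R * (galTrace k K x == 0)%:R.
Proof.
move=> skK Kx; have kT : galTrace k K x \in k by rewrite mem_galTrace ?finField_galois.
have DE c : c \in k -> add_char R K (c * x) = add_char R k (c * galTrace k K x).
  move=> kc; have Kcx : c * x \in K by rewrite rpredM // (subvP skK).
  by rewrite /add_char (galTrace_trans (sub1v k) skK Kcx) galTraceZ.
rewrite (eq_bigr _ DE); have [->|T0] := eqVneq.
  by under eq_bigr do rewrite mulr0 add_char0; rewrite sumr_const mulr1.
rewrite mulr0 -[RHS](sum_add_char k) [RHS](reindex_inj (mulIf T0)) /=.
by apply: eq_bigl => c; rewrite rpredMr // unitfE.
Qed.

End AddChar.

(** * Subfields as sets of roots of unity, and discrete logarithms *)

Lemma unity_root_gcd (L : fieldType) (x : L) i j : (0 < i)%N ->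
  (x ^+ gcdn i j == 1) = (x ^+ i == 1) && (x ^+ j == 1).
Proof.
move=> i0; have [xi1|xi1] /= := eqVneq (x ^+ i) 1; last first.
  apply: contraNF xi1 => /eqP xg1.
  by rewrite -(divnK (dvdn_gcdl i j)) mulnC exprM xg1 expr1n.
have [m prim_m dvd_mi] := prim_order_exists i0 xi1.
by rewrite -!(prim_order_dvd prim_m) dvdn_gcd dvd_mi.
Qed.

Section Subfields.
Variables (p : nat) (F : finFieldType) (charF : p \in [pchar F]).
Local Notation L := (pPrimeCharType charF).
Implicit Types (k K E : {subfield L}) (x y z : L).

Let pr_p : prime p := pcharf_prime charF.

Lemma card_subfield K : #|K| = (p ^ \dim K)%N.
Proof. by rewrite [LHS]card_vspace card_Fp. Qed.

Lemma mem_subfield K x : (x \in K) = (x ^+ #|K| == x).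
Proof. by rewrite Fermat's_little_theorem card_Fp // card_subfield. Qed.

Lemma card_subfield_gt1 K : (1 < #|K|)%N.
Proof. by rewrite card_subfield -(exp1n (\dim K)) ltn_exp2r ?prime_gt1 ?adim_gt0. Qed.

(** Dividing x^|K| = x by x gives the equivalence; through it, sums over K^* become sums over roots
    of unity. *)
Lemma unity_root_subfield K x : (x ^+ #|K|.-1 == 1) = (x \in K) && (x != 0).
Proof.
have K1 := card_subfield_gt1 K.
rewrite mem_subfield -[in RHS](prednK (ltnW K1)) exprS.
have : (0 < #|K|.-1)%N by rewrite -ltnS (ltn_predK K1).
move: #|K|.-1 => N N0; have [->|x0] := eqVneq x 0.
  by rewrite andbF expr0n eqn0Ngt N0 eq_sym oner_eq0.
by rewrite andbT -{4}[x]mulr1 (inj_eq (mulfI x0)).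
Qed.

Lemma sum_subfield K (V : nmodType) (f : L -> V) :
  \sum_(x in K) f x = f 0 + \sum_(x | x ^+ #|K|.-1 == 1) f x.
Proof.
rewrite (bigD1 0) ?rpred0 //=; congr (_ + _).
by apply: eq_bigl => x; rewrite unity_root_subfield.
Qed.

(** The order m of z divides |K| - 1; as the powers of z exhaust K^*, counting them gives |K| - 1 <=
    m. *)
Lemma primitive_element_root K z : primitive_element K z ->
  #|K|.-1.-primitive_root z.
Proof.
case=> Kz z0 genz; have K1 := card_subfield_gt1 K; have zQ1 : z ^+ #|K|.-1 = 1.
  by apply/eqP; rewrite unity_root_subfield Kz.
have Q0 : (0 < #|K|.-1)%N by rewrite -ltnS (ltn_predK K1).
have [m prim_m dvd_mQ] := prim_order_exists Q0 zQ1.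
suffices le_Qm : (#|K|.-1 <= m)%N.
  by have /eqP <- : m == #|K|.-1 by rewrite eqn_leq le_Qm dvdn_leq.
have /subset_leq_card : [set x in K | x != 0] \subset [set z ^+ (i : 'I_m) | i in predT].
  apply/subsetP => x; rewrite inE => /andP[Kx x0]; have [n ->] := genz _ Kx x0.
  apply/imsetP; exists (Ordinal (ltn_pmod n (prim_order_gt0 prim_m))) => //=.
  by rewrite prim_expr_mod.
move/leq_trans/(_ (leq_imset_card _ _)); rewrite card_ord; apply: leq_trans.
have -> : [set x in K | x != 0] = [set x in K] :\ 0 by apply/setP=> x; rewrite !inE andbC.
by rewrite -[#|K|]cardsE (cardsD1 0) inE rpred0.
Qed.

Lemma subfield_sub_card k K t : #|K| = (#|k| ^ t)%N -> (k <= K)%VS.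
Proof.
move=> cardK; apply/subvP => x; rewrite !mem_subfield cardK => /eqP xk.
by elim: (t) => //= n IHn; rewrite expnSr exprM (eqP IHn) xk.
Qed.

(** The bound on N places a suitable exponent inside the list searched by [ind], so the default
    value is not returned. *)
Lemma ind_primitive_root g y N : (N <= #|L|)%N -> N.-primitive_root g ->
  y ^+ N = 1 -> g ^+ ind g y = y.
Proof.
move=> leN prim_g /(prim_rootP prim_g)[i Dy].
have y_in : y \in [seq g ^+ n | n <- iota 0 #|L|].
  by rewrite Dy; apply/map_f; rewrite mem_iota add0n (leq_trans (ltn_ord i)).
have := y_in; rewrite -index_mem size_map size_iota => lt_ind.
by rewrite -[RHS](nth_index 0 y_in) (nth_map 0%N) ?size_iota // nth_iota.
Qed.

End Subfields.

(** * Evaluation of N_t(0, b) *)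

Theorem theorem3p2 (R : realType) (p r q m t : nat)
  (hp : prime p) (hr : (0 < r)%N) (hq : q = (p ^ r)%N) (hm : (2 <= m)%N)
  (* F = F_{q^m}, with its subfields Fq = F_q and Fqt = F_{q^t} *)
  (F : finFieldType) (charF : p \in [pchar F]) (hF : #|F| = (q ^ m)%N)
  (Fq Fqt : {subfield pPrimeCharType charF})
  (hFq : #|Fq| = q) (hFqt : #|Fqt| = (q ^ t)%N)
  (b : pPrimeCharType charF) (hb : b \in Fq) (hb0 : b != 0)
  (ht : (0 < t)%N) (htm : (t %| m)%N) (hpt : ~~ (p %| m %/ t)%N)
  (gamma : pPrimeCharType charF) (hgamma : primitive_element Fqt gamma)
  (g : pPrimeCharType charF) (hg : g = galNorm Fq Fqt gamma)
  (d : nat) (hd : d = gcdn (m %/ t) (q - 1))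
  (hdind : (d %| ind g b)%N)
  (i0 : int)
  (hi0 : ((m %/ (d * t))%N%:Z * i0
            = (ind g b %/ d)%N%:Z %[mod ((q - 1) %/ d)%N%:Z])%Z)
  (s : nat) (hs : s = gcdn t ((q - 1) %/ d)) :
  (count_trace_norm Fq Fqt 0 b)%:R =
    d%:R * ((q%:R ^+ (t - 1) - 1) / (q%:R - 1)
            + q%:R^-1 * \sum_(x : pPrimeCharType charF | x \in Fqt)
                          add_char R Fqt (gamma ^ i0 * x ^+ s)) :> R[i].
Proof.
have sub : (Fq <= Fqt)%VS by apply: (@subfield_sub_card _ _ _ _ _ t); rewrite hFqt hFq.
have q1 : (1 < q)%N by rewrite -hFq card_subfield_gt1.
have dimq : \dim Fq = r.
  by apply: (expnI (prime_gt1 hp)); rewrite -card_subfield hFq.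
have dimqt : \dim Fqt = (r * t)%N.
  by apply: (expnI (prime_gt1 hp)); rewrite -card_subfield hFqt hq expnM.
have dimL : \dim {: pPrimeCharType charF} = (r * m)%N.
  apply: (expnI (prime_gt1 hp)); rewrite -card_subfield expnM -hq -hF.
  by apply: eq_card => x; rewrite memvf.
pose n := (m %/ t)%N; rewrite -/n in hpt hd.
have Dt : \dim_Fq Fqt = t by rewrite dimq dimqt mulKn.
have Dn : \dim_Fqt {: pPrimeCharType charF} = n by rewrite dimL dimqt divnMl.
pose c := (\sum_(i < t) q ^ i)%N; pose Q := (q ^ t).-1.
have DQ : Q = (c * q.-1)%N by rewrite /Q predn_exp mulnC.
have Q0 : (0 < Q)%N by rewrite -ltnS (@ltn_predK 1) -hFqt card_subfield_gt1.
have [c0 q10] : (0 < c /\ 0 < q.-1)%N by apply/andP; rewrite -muln_gt0 -DQ.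
have d0 : (0 < d)%N by rewrite hd subn1 gcdn_gt0 q10 orbT.
have prim : Q.-primitive_root gamma by have := primitive_element_root hgamma; rewrite hFqt.
have normE x : x \in Fqt -> galNorm Fq {: pPrimeCharType charF} x = x ^+ (c * n).
  move=> Kx; rewrite (galNorm_sub sub (subvf _)) // Dn galNormE // Dt.
  by rewrite card_Fp // dimq -hq exprM.
(* The trace from the large field is n times the trace from [Fqt], and n is nonzero in
   characteristic p. *)
have trE x : x \in Fqt -> (galTrace Fq {: pPrimeCharType charF} x == 0) = (galTrace Fq Fqt x == 0).
  move=> Kx; rewrite (galTrace_sub sub (subvf _)) // Dn -mulr_natr mulf_eq0.
  by rewrite -(dvdn_pcharf (charF : p \in [pchar (pPrimeCharType charF)])) (negPf hpt) orbF.
have gE : g = gamma ^+ c.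
  by case: hgamma => Kg _ _; rewrite hg galNormE // Dt card_Fp // dimq -hq.
have primg : q.-1.-primitive_root g.
  have := prim; rewrite DQ => primQ.
  by have := dvdn_prim_root primQ (dvdn_mull c (dvdnn q.-1)); rewrite mulnK // -gE.
have gb : g ^+ ind g b = b.
  apply: (@ind_primitive_root _ _ _ _ _ q.-1) => //.
    rewrite [#|_|]hF; apply: leq_trans (leq_pred _) _.
    by rewrite -{1}[q]expn1 leq_exp2l // ltnW.
  by apply/eqP; rewrite -hFq unity_root_subfield hb.
pose M := (q.-1 %/ d)%N.
have dq : (d %| q.-1)%N by rewrite hd subn1 dvdn_gcdr.
have dn : (d %| n)%N by rewrite hd dvdn_gcdl.
have DM : q.-1 = (M * d)%N by rewrite divnK.
rewrite subn1 -/M in hi0 hs hd.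
have gamma0 : gamma != 0 by case: hgamma.
pose B := gamma ^ i0.
have Bq : B \in Fqt by case: hgamma => Kg _ _; rewrite rpredXz.
have B0 : B != 0 by rewrite expfz_neq0.
(* Multiplying the congruence for i0 by d gives n i0 = ind_g b + (q - 1) k; since g = gamma^c has
   order q - 1, B^(c n) = g^(n i0) = b. *)
have BE : B ^+ (c * n) = b.
  have /dvdzP[k Dk] : (M %| (n %/ d)%N%:Z * i0 - (ind g b %/ d)%N%:Z)%Z.
    by rewrite -eqz_mod_dvd; apply/eqP; rewrite -hi0 [(d * t)%N]mulnC divnMA.
  have Di0 : n%:Z * i0 = (ind g b)%:Z + q.-1%:Z * k.
    rewrite -(divnK dn) -(divnK hdind) DM !PoszM; move/eqP: Dk; rewrite subr_eq => /eqP Dk.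
    by rewrite mulrAC Dk; ring.
  rewrite exprnP /B exprz_exp PoszM mulrCA [i0 * _]mulrC Di0 -exprz_exp -exprnP -gE.
  have g0 : g != 0 by rewrite gE expf_neq0.
  by rewrite expfzDr // -exprz_exp -!exprnP (prim_expr_order primg) exp1rz mulr1.
(* As M divides q - 1, each q^i is 1 modulo M, whence c = t modulo M. *)
have sE : s = gcdn c M.
  rewrite hs -gcdn_modl -[RHS]gcdn_modl; congr (gcdn _ _).
  rewrite /c -modn_summ -[X in (X %% _)%N = _]muln1 -[X in (X * 1)%N]card_ord -sum_nat_const.
  rewrite -modn_summ; congr (_ %% _)%N; apply: eq_bigr => i _.
  have qM : (q = 1 %[mod M])%N.
    by rewrite -(prednK (ltnW q1)) DM -addn1 mulnC modnMDl.
  by rewrite -modnXm qM modnXm exp1n.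
pose f y := add_char R Fqt (B * y).
have count : (count_trace_norm Fq Fqt 0 b)%:R =
    \sum_(z : pPrimeCharType charF | z ^+ (c * d) == 1) (galTrace Fq Fqt (B * z) == 0)%:R :> R[i].
  rewrite /count_trace_norm cardsE -sum1_card natr_sum (reindex_inj (mulfI B0)) /=.
  rewrite -[RHS](eq_bigr _ (fun _ _ => esym (mulrb _ _))) -big_mkcondr /=.
  apply: eq_bigl => z.
  (* After x = B z, membership in K^* reads z^Q = 1 and the norm condition z^(c n) = 1; with Q = c
     (q - 1), they combine into z^(c d) = 1. *)
  have -> : (c * d = gcdn Q (c * n))%N by rewrite DQ -muln_gcdr gcdnC -hd.
  rewrite unity_root_gcd // /Q -hFqt unity_root_subfield.
  rewrite unfold_in.
  have -> : (B * z \in Fqt) = (z \in Fqt).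
    by rewrite mulrC rpredMr ?unitfE.
  rewrite mulf_eq0 (negPf B0) /=.
  have [Kz|//] := boolP (z \in Fqt); have KBz : B * z \in Fqt by rewrite rpredM.
  rewrite trE // normE // exprMn BE -{2}[b]mulr1 (inj_eq (mulfI hb0)) /=.
  by rewrite -andbA [(_ == 0) && _]andbC.
have q0 : q%:R != 0 :> R[i] by rewrite pnatr_eq0 -lt0n ltnW.
have q10' : q%:R - 1 != 0 :> R[i] by rewrite -(natrB _ (ltnW q1)) pnatr_eq0 subn1 -lt0n.
have cardU N : (N %| Q)%N ->
    \sum_(z : pPrimeCharType charF | z ^+ N == 1) 1 = N%:R :> R[i].
  move=> /(dvdn_prim_root prim) primN; rewrite (sum_unity_roots _ primN).
  by rewrite sumr_const card_ord.
set D := \sum_(w : pPrimeCharType charF | w ^+ q.-1 == 1)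
           \sum_(z : pPrimeCharType charF | z ^+ (c * d) == 1) f (w * z).
(* Orthogonality over [Fq]: the zero multiplier contributes 1 for each of the c d values of z, and
   the nonzero multipliers make up [D]. *)
have qN : q%:R * (count_trace_norm Fq Fqt 0 b)%:R = (c * d)%:R + D.
  rewrite count mulr_sumr -(cardU (c * d)%N); last by rewrite DQ dvdn_mul.
  rewrite /D exchange_big -big_split /=; apply: eq_bigr => z zcd.
  have Kz : z \in Fqt.
    have : z ^+ Q == 1 by rewrite DQ DM mulnCA mulnC exprM (eqP zcd) expr1n.
    by rewrite /Q -hFqt unity_root_subfield => /andP[].
  rewrite -{1}hFq -(sum_add_charM R sub) ?rpredM // sum_subfield hFq mul0r add_char0.
  by congr (_ + _); apply: eq_bigr => w _; rewrite /f mulrCA.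
(* Lifting z to y^M and the multiplier to w^c, with w and y Q-th roots of unity, counts every term
   of [D] exactly c M times. *)
have DE : (c * M)%:R * D
    = Q%:R * \sum_(x : pPrimeCharType charF | x ^+ Q == 1) f (x ^+ s).
  have QM : Q = (M * (c * d))%N by rewrite DQ DM mulnCA.
  have cardQ : #|[pred x : pPrimeCharType charF | x ^+ Q == 1]| = Q.
    by apply/eqP; rewrite -(@eqr_nat R[i]) -(cardU Q) // sumr_const.
  rewrite sE [RHS]mulr_natl -[X in _ = _ *+ X]cardQ -(sum_unity_roots_gcd M f Q0 c0).
  have inner w : \sum_(y : pPrimeCharType charF | y ^+ Q == 1) f (w ^+ c * y ^+ M)
      = (\sum_(z : pPrimeCharType charF | z ^+ (c * d) == 1) f (w ^+ c * z)) *+ M.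
    have := prim; rewrite QM => primQ.
    exact: (sum_unity_roots_exp (fun z => f (w ^+ c * z)) primQ).
  rewrite (eq_bigr _ (fun w _ => inner w)) sumrMnl.
  have := prim; rewrite DQ => primQ.
  rewrite (sum_unity_roots_exp
    (fun w => \sum_(z : pPrimeCharType charF | z ^+ (c * d) == 1) f (w * z)) primQ).
  by rewrite -mulrnA mulr_natl.
have cM0 : (c * M)%:R != 0 :> R[i].
  by rewrite pnatr_eq0 -lt0n muln_gt0 c0 divn_gt0 // dvdn_leq.
have DE' : D = d%:R * \sum_(x : pPrimeCharType charF | x ^+ Q == 1) f (x ^+ s).
  by apply: (mulfI cM0); rewrite DE mulrA -natrM -mulnA -DM -DQ.
have cE : (q%:R - 1) * c%:R = q%:R * q%:R ^+ (t - 1) - 1 :> R[i].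
  have qt0 : (0 < q ^ t)%N by rewrite expn_gt0 ltnW.
  rewrite -exprS subn1 prednK // -natrX -(natrB _ (ltnW q1)) -(natrB _ qt0) !subn1.
  by rewrite predn_exp natrM.
have s0 : (0 < s)%N by rewrite hs gcdn_gt0 ht.
(* Since s > 0, the term x = 0 equals e(0) = 1; it accounts for the difference between c and (q^t -
   q) / (q - 1) = c - 1. *)
rewrite sum_subfield hFqt -/Q expr0n eqn0Ngt s0 mulr0 add_char0.
apply: (mulfI q0); rewrite qN DE' natrM.
have -> : q%:R ^+ (t - 1) = ((q%:R - 1) * c%:R + 1) / q%:R :> R[i].
  by rewrite cE subrK mulrC mulKf.
by rewrite -/f; field; rewrite q0.
Qed.
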